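(* Let $J=\{1,\ldots,N\}$, $k\le N$ with $N/k$ an integer, let $\mathscr{S}=\{\{\tau,\tau+1,\ldots,\tau+k-1\}:1\le\tau\le N-k+1\}$ (the SOS$k(N)$ constraint on $J$), and let $G^c_{\mathscr{S}}$ be the corresponding conflict graph. Let $\{(\tilde A^{1,j},\tilde B^{1,j})\}_{j=1}^{t_1}$ be a biclique cover of the conflict graph of the SOS2$(N/k)$ constraint, and for all $j'\in\{1,\ldots,3k\}$ take $$A^{2,j'}=\bigcup_{i=0}^{\lceil N/(3k)\rceil}\{\tau\in J:\tau=j'+(3i-3)k\},$$ $$B^{2,j'}=\bigcup_{i=0}^{\lceil N/(3k)\rceil}\{\tau\in J:j'+(3i-2)k\le\tau\le j'+(3i-1)k\}.$$ Then $\{(A^{1,j},B^{1,j})\}_{j=1}^{t_1}\cup\{(A^{2,j'},B^{2,j'})\}_{j'=1}^{3k}$ is a biclique cover of $G^c_{\mathscr{S}}$, where $$A^{1,j}=\{\tau\in J:\lceil\tau/k\rceil\in\tilde A^{1,j}\},\qquad B^{1,j}=\{\tau\in J:\lceil\tau/k\rceil\in\tilde B^{1,j}\}\qquad(1\le j\le t_1).$$ In particular, if $\{h^i\}_{i=1}^{\lceil N/k\rceil-1}\subseteq\{0,1\}^{\lceil\log_2(\lceil N/k\rceil-1)\rceil}$ is a Gray code, where $h^0:=h^1$ and $h^{\lceil N/k\rceil}:=h^{\lceil N/k\rceil-1}$, then a biclique cover of $G^c_{\mathscr{S}}$ of depth $\lceil\log_2(\lceil N/k\rceil-1)\rceil+3k$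 is given by $\{(A^{1,j},B^{1,j})\}_{j=1}^{\lceil\log_2(\lceil N/k\rceil-1)\rceil}\cup\{(A^{2,j'},B^{2,j'})\}_{j'=1}^{3k}$, where $$A^{1,j}=\{\tau\in J:h^{\lceil\tau/k\rceil-1}_j=h^{\lceil\tau/k\rceil}_j=0\},\qquad B^{1,j}=\{\tau\in J:h^{\lceil\tau/k\rceil-1}_j=h^{\lceil\tau/k\rceil}_j=1\}$$ for all $j\in\{1,\ldots,\lceil\log_2(\lceil N/k\rceil-1)\rceil\}$.
   Context: For a family $\mathscr{S}$ of subsets of a finite set $J$, a set $T\subseteq J$ is infeasible if it is contained in no $S\in\mathscr{S}$. The conflict graph is $G^c_{\mathscr{S}}=(J,\bar E)$ with $\bar E$ the set of infeasible two-element subsets of $J$. SOS2$(m)$ is the constraint on ground set $\{1,\ldots,m\}$ given by the family $\{\{\tau,\tau+1\}:1\le\tau\le m-1\}$; the edges of its conflict graph are the pairs $\{r,s\}$ with $|r-s|\ge 2$. A biclique cover of a graph $G=(J,E)$ is a collection of complete bipartite subgraphs of $G$, given by pairs $\{(A^j,B^j)\}_{j=1}^t$, that cover all edges of $G$; formally, for each $j$, $\emptyset\subsetneq A^j,B^j\subsetneq J$, $A^j\cap B^j=\emptyset$, and $\bigcup_{j=1}^t A^j*B^j=E$, where $A*B=\{\{a,b\}:a\in A,\ b\in B\}$. Its depth is the number $t$ of pairs. A Gray code is a sequence of distinct binary vectors in which each pair of consecutive vectors differs in exactly one component; $h_j$ denotes the $j$-th component of $h$.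
   Formalization: If N < 3k (N = k or 2k), A^{2,3k} is empty, so the stated family is not a biclique cover. The full family is claimed to be a cover only for N ≥ 3k; for every N, it is claimed after discarding pairs with an empty side. The count of log term + 3k is for the full list of pairs. *)

(* Defs.v *)
From mathcomp Require Import all_boot all_order all_algebra.

Set Implicit Arguments.
Unset Strict Implicit.
Unset Printing Implicit Defensive.

Local Open Scope nat_scope.

Section SetFamilies.
Variable J : finType.
Implicit Types (F : {set {set J}}) (c : seq ({set J} * {set J})).

Definition infeasible F (T : {set J}) : bool := [forall S in F, ~~ (T \subset S)].

(* A graph on J is given by its edge set, a set of two-element subsets of J. *)
Definition conflict_graph F : {set {set J}} :=
  [set e : {set J} | (#|e| == 2) && infeasible F e].

Definition join_edges (A B : {set J}) : {set {set J}} :=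
  [set [set a; b] | a in A, b in B].

(* A finite indexed family of pairs is a sequence (repetitions allowed), so the
   depth of a cover c is size c. *)
Definition biclique_cover (E : {set {set J}}) c : Prop :=
  (forall p, p \in c ->
     [/\ set0 \proper p.1, p.1 \proper [set: J],
         set0 \proper p.2, p.2 \proper [set: J] & p.1 :&: p.2 = set0])
  /\ \bigcup_(p <- c) join_edges p.1 p.2 = E.

(* Some constructions indexed by a fixed range produce pairs with an empty side on
   small ground sets; such a pair covers no edge and is not a biclique. *)
Definition nonempty_pairs c := [seq p <- c | (p.1 != set0) && (p.2 != set0)].

End SetFamilies.

(* The ground set {1, ..., m} is 'I_m, where i : 'I_m stands for the number
   i + 1. *)
Definition sos_label (m : nat) (i : 'I_m) : nat := i.+1.

Definition cdivn (a d : nat) : nat := (a + d.-1) %/ d.  (* ceiling of a / d *)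

(* For k >= 1, sos_label t + k <= m + 1 says that t ranges up to m - k + 1, without
   truncated subtraction. *)
Definition SOS (k m : nat) : {set {set 'I_m}} :=
  [set [set s : 'I_m | sos_label t <= sos_label s <= sos_label t + k - 1]
     | t : 'I_m & sos_label t + k <= m + 1].

Definition block_preim (N k m : nat) (A : {set 'I_m}) : {set 'I_N} :=
  [set t : 'I_N | [exists r in A, sos_label r == cdivn (sos_label t) k]].

(* Stated over int, since 3 i - 3 and 3 i - 2 can be negative.
   For 1 <= j <= 3k, both shift_A and shift_B are nonempty as soon as 3k <= N.
   If N is k or 2k, then shift_A N k (3k) is empty. *)
Definition shift_A (N k j : nat) : {set 'I_N} :=
  \bigcup_(i < (cdivn N (3 * k)).+1)
    [set t : 'I_N | ((sos_label t)%:Z == j%:Z + (3 * i%:Z - 3) * k%:Z)%R].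

Definition shift_B (N k j : nat) : {set 'I_N} :=
  \bigcup_(i < (cdivn N (3 * k)).+1)
    [set t : 'I_N | (j%:Z + (3 * i%:Z - 2) * k%:Z <= (sos_label t)%:Z
                       <= j%:Z + (3 * i%:Z - 1) * k%:Z)%R].

Definition block_family (N k m : nat) (c : seq ({set 'I_m} * {set 'I_m})) :
    seq ({set 'I_N} * {set 'I_N}) :=
  [seq (block_preim N k p.1, block_preim N k p.2) | p <- c].

Definition shift_family (N k : nat) : seq ({set 'I_N} * {set 'I_N}) :=
  [seq (shift_A N k j, shift_B N k j) | j <- iota 1 (3 * k)].

Definition gray_code (L : nat) (s : seq {ffun 'I_L -> bool}) : bool :=
  uniq s
  && sorted (fun u v : {ffun 'I_L -> bool} => #|[set j | u j != v j]| == 1) s.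

(* The bits 0 and 1 are false and true. *)
Definition gray_set (N k L : nat) (h : nat -> {ffun 'I_L -> bool}) (b : bool)
    (j : 'I_L) : {set 'I_N} :=
  [set t : 'I_N | (h (cdivn (sos_label t) k - 1) j == b)
                    && (h (cdivn (sos_label t) k) j == b)].

Definition gray_family (N k L : nat) (h : nat -> {ffun 'I_L -> bool}) :
    seq ({set 'I_N} * {set 'I_N}) :=
  [seq (gray_set N k h false j, gray_set N k h true j) | j <- enum 'I_L].

(* Main.v *)
(* An edge of the conflict graph of SOS k N is a pair at distance at least k; cut
   the ground set into N / k blocks of length k. If the blocks of the endpoints
   differ by at least 2, the edge is covered by pulling back the SOS2 cover; if
   they are adjacent, the distance is less than 2 k, and the shifted family
   covers the edge through the residue modulo 3 k of its smaller endpoint.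
   The Gray code sets are the pullbacks of those for k = 1, so it remains to see
   that these form a biclique cover of the SOS2 conflict graph. *)
Require Import Defs.
From mathcomp Require Import all_boot.
From mathcomp Require Import zify.

Local Open Scope nat_scope.

(** * Biclique covers, edge by edge *)

(** Empty sides are left out of account, so the property survives discarding the pairs that have
    one. *)
Definition covers_edges {J : finType} (E : {set {set J}}) (c : seq ({set J} * {set J})) : Prop :=
  (forall p a b, p \in c -> a \in p.1 -> b \in p.2 -> [set a; b] \in E)
  /\ (forall a b, [set a; b] \in E ->
        exists2 p, p \in c & (a \in p.1) && (b \in p.2) || (b \in p.1) && (a \in p.2)).

(** A common element of the two sides would give an edge with one element, so the sides are
    disjoint; then neither is all of [J], as the other would be empty. *)
Lemma biclique_coverP {J : finType} (E : {set {set J}}) (c : seq ({set J} * {set J})) :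
  {in E, forall e : {set J}, #|e| = 2} ->
  biclique_cover E c <->
  {in c, forall p, (p.1 != set0) && (p.2 != set0)} /\ covers_edges E c.
Proof.
move=> E2; split=> [[c_proper cE]|[c_neq0 [sound complete]]].
  split=> [p /c_proper[p1 _ p2 _ _]|]; first by rewrite -!proper0 p1.
  split=> [p a b pc ap bp|a b].
    by rewrite -cE bigcup_seq; apply/bigcupP; exists p => //; apply: imset2_f.
  rewrite -{}cE bigcup_seq => /bigcupP[p pc /imset2P[a' b' a'p b'p /setP eq_ab]].
  (* Two of the four cases put [a'] and [b'] at the same point; the tests at [a] and [b] then force
     [a = b]. *)
  exists p => //; have := eq_ab a; have := eq_ab b; have := eq_ab a'; have := eq_ab b'.
  rewrite !inE !eqxx !orbT => /orP[]/eqP eb' /orP[]/eqP ea' /esym eb /esym ea; subst a' b'.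
  - by move: eb; rewrite orbb => /eqP->; rewrite a'p b'p.
  - by rewrite a'p b'p orbT.
  - by rewrite a'p b'p.
  - by move: ea; rewrite orbb => /eqP->; rewrite a'p b'p.
have p_dis p : p \in c -> p.1 :&: p.2 = set0.
  move=> pc; apply/eqP/set0Pn => -[a /setIP[ap1 ap2]].
  by have /E2 := sound _ _ _ pc ap1 ap2; rewrite setUid cards1.
split=> [p pc|].
  have /andP[p1 p2] := c_neq0 p pc; have dis := p_dis p pc.
  rewrite !proper0 !properT p1 p2; split=> //.
    by apply: contraNneq p2 => eqT; rewrite -dis eqT setTI.
  by apply: contraNneq p1 => eqT; rewrite -dis eqT setIT.
apply/setP=> e; rewrite bigcup_seq; apply/bigcupP/idP=> [[p pc]|eE].
  by case/imset2P=> a b ap bp ->; apply: sound pc ap bp.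
have /eqP/cards2P[a [b [_ e_ab]]] := E2 e eE; rewrite e_ab in eE *.
have [p pc /orP[]/andP[xp yp]] := complete a b eE; exists p; rewrite ?pc //.
  exact: imset2_f.
by rewrite setUC; apply: imset2_f.
Qed.

Lemma covers_nonempty_pairs {J : finType} (E : {set {set J}}) (c : seq ({set J} * {set J})) :
  covers_edges E c -> covers_edges E (nonempty_pairs c).
Proof.
case=> sound complete; split=> [p a b|a b /complete[p pc ab]].
  by rewrite mem_filter => /andP[_]; apply: sound.
exists p => //; rewrite mem_filter pc andbT.
by apply/andP; split; apply/set0Pn; case/orP: ab => /andP[? ?]; by [exists a|exists b].
Qed.

(** * Conflict graphs of SOS constraints *)

Lemma card_conflict_edge {J : finType} (F : {set {set J}}) :
  {in conflict_graph F, forall e : {set J}, #|e| = 2}.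
Proof. by move=> e; rewrite inE => /andP[/eqP]. Qed.

(** The side condition says that a window of length [k] fits, or that there are no two distinct
    points; the latter occurs for SOS2 on a single block. *)
Lemma edge_conflict_SOS (k m : nat) (a b : 'I_m) :
  0 < k -> (k <= m) || (m <= 1) ->
  ([set a; b] \in conflict_graph (SOS k m)) = (a + k <= b) || (b + k <= a).
Proof.
move=> k_gt0 km; rewrite inE cards2 /infeasible.
wlog le_ab: a b / a <= b => [IH|].
  have [/IH//|/ltnW/IH] := leqP a b.
  by rewrite setUC (eq_sym b a) orbC.
have ltam := ltn_ord a; have ltbm := ltn_ord b.
have [lt_ab|ge_ab] := ltnP b (a + k); last first.
  have -> : a != b by apply/eqP=> e; move: ge_ab; rewrite e; lia.
  rewrite /=; apply/forall_inP=> S /imsetP[t]; rewrite inE /sos_label => _ ->.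
  apply/negP=> /subsetP sub; have := sub a; have := sub b.
  by rewrite !inE !eqxx orbT /= /sos_label => /(_ isT) ? /(_ isT) ?; lia.
have -> : (b + k <= a) = false by lia.
have [//|neq_ab] := eqVneq a b.
have {}neq_ab : (a : nat) <> b by move=> /val_inj/eqP; rewrite (negPf neq_ab).
apply/negbTE/forall_inPn => /=.
(* The window starts at [a], or earlier if it would run past the end. *)
have tm : minn a (m - k) < m by lia.
exists [set s : 'I_m | sos_label (Ordinal tm) <= sos_label s <= sos_label (Ordinal tm) + k - 1].
  by apply/imsetP; exists (Ordinal tm) => //; rewrite inE /sos_label /=; lia.
rewrite negbK; apply/subsetP=> s; rewrite !inE /sos_label /=.
by move=> /orP[]/eqP->; lia.
Qed.

(** * Membership in block preimages and shifted sets *)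

Lemma cdivnS (k n : nat) : 0 < k -> cdivn n.+1 k = (n %/ k).+1.
Proof. by move=> k_gt0; rewrite /cdivn addSnnS prednK // divnDr // divnn k_gt0 addn1. Qed.

Lemma mem_block_preim (N k m : nat) (A : {set 'I_m}) (t : 'I_N) (r : 'I_m) :
  0 < k -> t %/ k = r -> (t \in block_preim N k A) = (r \in A).
Proof.
move=> k_gt0 tr; rewrite inE /sos_label cdivnS // tr.
apply/exists_inP/idP=> [[s sA]|rA]; last by exists r.
by rewrite eqSS => /eqP/val_inj<-.
Qed.

Lemma mem_shift_A (N k j : nat) (t : 'I_N) :
  t \in shift_A N k j <->
  exists2 i, i <= cdivn N (3 * k) & t.+1 + 3 * k = j + 3 * i * k.
Proof.
split=> [/bigcupP[i _]|[i le_i ti]].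
  by rewrite inE /sos_label => ti; exists i; [rewrite -ltnS|lia].
apply/bigcupP; exists (Ordinal (n:=(cdivn N (3 * k)).+1) (m:=i) le_i) => //.
by rewrite inE /sos_label /=; lia.
Qed.

Lemma mem_shift_B (N k j : nat) (t : 'I_N) :
  t \in shift_B N k j <->
  exists2 i, i <= cdivn N (3 * k)
    & j + 3 * i * k <= t.+1 + 2 * k /\ t.+1 + k <= j + 3 * i * k.
Proof.
split=> [/bigcupP[i _]|[i le_i ti]].
  by rewrite inE /sos_label => ti; exists i; [rewrite -ltnS|lia].
apply/bigcupP; exists (Ordinal (n:=(cdivn N (3 * k)).+1) (m:=i) le_i) => //.
by rewrite inE /sos_label /=; lia.
Qed.

(** The window of [shift_B] with index [i'] lies between the consecutive points of [shift_A] with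
    indices [i'] and [i'.+1], at distance [k] from each. *)
Lemma shift_A_B_dist (N k j : nat) (a b : 'I_N) :
  a \in shift_A N k j -> b \in shift_B N k j -> (a + k <= b) || (b + k <= a).
Proof.
move=> /mem_shift_A[i _ ai] /mem_shift_B[i' _ [bi bi']].
have [le_i|lt_i] := leqP i i'; apply/orP; [left|right].
  by have := leq_mul le_i (leqnn k); lia.
by have := leq_mul lt_i (leqnn k); lia.
Qed.

(** The window following a point [a] of [shift_A] is exactly the range from [a + k] to [a + 2 * k].
    The residue of [a] modulo [3 * k] selects the pair and the quotient the index, both raised by
    one. *)
Lemma shift_family_complete (N k : nat) (a b : 'I_N) :
  0 < k -> a + k <= b -> b <= a + 2 * k ->
  exists2 p, p \in shift_family N k & (a \in p.1) && (b \in p.2).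
Proof.
move=> k_gt0 ab ba.
have aE := divn_eq a (3 * k); have := ltn_pmod a (d := 3 * k).
rewrite muln_gt0 k_gt0 => /(_ isT) a_lt.
have le_i : (a %/ (3 * k)).+1 <= cdivn N (3 * k).
  have := leq_div2r (3 * k) (ltn_ord a); rewrite -cdivnS ?muln_gt0 ?k_gt0 //.
  by move=> _; apply: leq_div2r; rewrite leq_add2r.
exists (shift_A N k (a %% (3 * k)).+1, shift_B N k (a %% (3 * k)).+1).
  by apply/mapP; exists (a %% (3 * k)).+1 => //; rewrite mem_iota; lia.
apply/andP; split; [apply/mem_shift_A|apply/mem_shift_B]; exists (a %/ (3 * k)).+1 => //; lia.
Qed.

Lemma shift_family_neq0 (N k : nat) :
  0 < k -> 3 * k <= N ->
  {in shift_family N k, forall p, (p.1 != set0) && (p.2 != set0)}.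
Proof.
move=> k_gt0 kN p /mapP[j]; rewrite mem_iota => j_in -> /=.
have c_gt0 : 0 < cdivn N (3 * k) by rewrite divn_gt0; lia.
have jN : j.-1 < N by lia.
apply/andP; split; apply/set0Pn.
  by exists (Ordinal jN); apply/mem_shift_A; exists 1 => //=; lia.
(* The window of index 1 starts at label [j + k], which may pass [N] for large [j]; the window of
   index 0 then starts at the positive label [j - 2 * k]. *)
have [le_j|lt_j] := leqP j (2 * k).
  have tN : (j + k).-1 < N by lia.
  by exists (Ordinal tN); apply/mem_shift_B; exists 1 => //=; lia.
have tN : (j - 2 * k).-1 < N by lia.
by exists (Ordinal tN); apply/mem_shift_B; exists 0 => //=; lia.
Qed.

(** * Pulling back a cover along the blocks *)

Section Blocks.
Context (N k : nat) (k_gt0 : 0 < k) (k_le_N : k <= N) (k_dvd_N : k %| N).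

Lemma block_lt (t : 'I_N) : t %/ k < N %/ k.
Proof. by rewrite ltn_divLR // divnK. Qed.

Lemma block_preim_neq0 (A : {set 'I_(N %/ k)}) : A != set0 -> block_preim N k A != set0.
Proof.
case/set0Pn=> r rA; apply/set0Pn.
have rN : r * k < N by rewrite -ltn_divRL.
by exists (Ordinal rN); rewrite (mem_block_preim _ _ _ _ _ r k_gt0) //= mulnK.
Qed.

(** For soundness, two blocks whose numbers differ by at least 2 have a whole block of length [k]
    between them. *)
Lemma covers_block_shift (c : seq ({set 'I_(N %/ k)} * {set 'I_(N %/ k)})) :
  covers_edges (conflict_graph (SOS 2 (N %/ k))) c ->
  covers_edges (conflict_graph (SOS k N)) (block_family N k c ++ shift_family N k).
Proof.
have blockE A (t : 'I_N) : (t \in block_preim N k A) = (Ordinal (block_lt t) \in A).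
  exact: mem_block_preim.
have edge2 (r s : 'I_(N %/ k)) :
    ([set r; s] \in conflict_graph (SOS 2 (N %/ k))) = (r + 2 <= s) || (s + 2 <= r).
  by rewrite edge_conflict_SOS //; lia.
have far (a b : 'I_N) : a %/ k + 2 <= b %/ k -> a + k <= b.
  move=> /(leq_mul (leqnn k)); have := divn_eq a k; have := divn_eq b k.
  by have := ltn_pmod a k_gt0; lia.
case=> sound complete; split=> [p a b|a b].
  rewrite edge_conflict_SOS ?k_le_N // mem_cat => /orP[/mapP[q qc ->]|/mapP[j _ ->]] /=.
    rewrite !blockE => aq bq; have := sound _ _ _ qc aq bq.
    by rewrite edge2 /= => /orP[]/far->; rewrite ?orbT.
  exact: shift_A_B_dist.
wlog ab : a b / a + k <= b => [IH ab|_].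
  move: (ab); rewrite edge_conflict_SOS ?k_le_N // => /orP[/IH|/IH]; first exact.
  by rewrite setUC => /(_ ab)[p pc pab]; exists p; rewrite // orbC.
have [ge2|lt2] := leqP (a %/ k + 2) (b %/ k); last first.
  have [|p pc pab] := shift_family_complete _ _ _ _ k_gt0 ab.
    have := leq_mul (leqnn k) lt2; have := divn_eq a k; have := divn_eq b k.
    by have := ltn_pmod b k_gt0; lia.
  by exists p; rewrite ?pab // mem_cat pc orbT.
have [|q qc abq] := complete (Ordinal (block_lt a)) (Ordinal (block_lt b)).
  by rewrite edge2 /= ge2.
exists (block_preim N k q.1, block_preim N k q.2); last by rewrite /= !blockE.
by rewrite mem_cat map_f.
Qed.

Lemma biclique_cover_block_shift (c : seq ({set 'I_(N %/ k)} * {set 'I_(N %/ k)})) :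
  biclique_cover (conflict_graph (SOS 2 (N %/ k))) c ->
  (3 * k <= N ->
     biclique_cover (conflict_graph (SOS k N)) (block_family N k c ++ shift_family N k))
  /\ biclique_cover (conflict_graph (SOS k N))
       (nonempty_pairs (block_family N k c ++ shift_family N k)).
Proof.
case/(biclique_coverP _ _ (card_conflict_edge _)) => c_neq0 /covers_block_shift covers.
split=> [kN|]; apply/(biclique_coverP _ _ (card_conflict_edge _)).
  split=> // p; rewrite mem_cat => /orP[/mapP[q /c_neq0/andP[q1 q2] ->]|].
    by rewrite !block_preim_neq0.
  exact: shift_family_neq0.
by split; [move=> p; rewrite mem_filter => /andP[]|apply: covers_nonempty_pairs].
Qed.
End Blocks.

(** * Gray codes and separating bits *)

Lemma gray_code_inj (L n : nat) (h : nat -> {ffun 'I_L -> bool}) :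
  gray_code [seq h i | i <- iota 1 n] ->
  forall i i', 0 < i <= n -> 0 < i' <= n -> h i = h i' -> i = i'.
Proof.
case/andP=> h_uniq _ [|i] // [|i'] // /= lt_i lt_i' eq_h.
have nthE l : l < n -> nth (h 0) [seq h l | l <- iota 1 n] l = h l.+1.
  by move=> lt_l; rewrite (nth_map 0) ?size_iota // nth_iota.
have := nth_uniq (h 0) (s := [seq h l | l <- iota 1 n]) (i := i) (j := i').
by rewrite size_map size_iota !nthE // eq_h eqxx => /(_ lt_i lt_i' h_uniq)/esym/eqP->.
Qed.

Lemma gray_code_step (L n : nat) (h : nat -> {ffun 'I_L -> bool}) :
  gray_code [seq h i | i <- iota 1 n] ->
  forall i, 0 < i < n -> #|[set l | h i l != h i.+1 l]| = 1.
Proof.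
case/andP=> _ /(sortedP (h 0)); rewrite size_map size_iota => step [|i] // /= lt_i.
apply/eqP; have := step i lt_i.
by rewrite !(nth_map 0) ?size_iota ?nth_iota // ltnW.
Qed.

(** Where [u] and [v] differ, one of them has the bit of [y], and there is at most one such
    place. *)
Lemma choose_agreeing {I : finType} (u v y : {ffun I -> bool}) :
  #|[set l | u l != v l]| <= 1 ->
  exists2 u' : {ffun I -> bool}, u' = u \/ u' = v
    & forall l, u l != v l -> u' l = y l.
Proof.
move/card_le1_eqP=> diff1.
have [l | no_diff] := pickP [pred l | u l != v l]; last first.
  by exists u; [left|move=> l; have /= -> := no_diff l].
rewrite /= => uv_l.
have only_l l' : u l' != v l' -> l' = l by move=> uv_l'; apply: diff1; rewrite inE.
have [uy_l|uy_l] := eqVneq (u l) (y l).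
  by exists u; [left|move=> l' /only_l->].
exists v; [by right|move=> l' /only_l->].
by move: uv_l uy_l; case: (u l) (v l) (y l) => [] [] [].
Qed.

(* If no coordinate separated {u, v} from {w, x}, then some vector of {u, v}
   would equal some vector of {w, x}: at each of the at most two coordinates
   where a pair disagrees internally, one is free to choose. *)
Lemma separating_coordinate {I : finType} (u v w x : {ffun I -> bool}) :
  #|[set l | u l != v l]| <= 1 -> #|[set l | w l != x l]| <= 1 ->
  u != w -> u != x -> v != w -> v != x ->
  exists l, [&& u l == v l, w l == x l & u l != w l].
Proof.
move=> uv1 wx1 uw ux vw vx; apply/existsP; apply: contraT.
rewrite negb_exists => /forallP no_sep.
(* [u'] copies [w] where [u] and [v] differ; [w'], chosen afterwards, copies [u'] where [w] and [x]
   differ. *)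
have [u' u'E u'w] := choose_agreeing u v w uv1.
have [w' w'E w'u'] := choose_agreeing w x u' wx1.
suff eq_uw : u' = w'.
  by case: u'E w'E eq_uw uw ux vw vx => -> [] -> ->; rewrite eqxx.
apply/ffunP=> l.
have [wx_l|/w'u'//] := eqVneq (w l) (x l).
have -> : w' l = w l by case: w'E => ->.
have [uv_l|/u'w//] := eqVneq (u l) (v l).
have -> : u' l = u l by case: u'E => ->.
by have := no_sep l; rewrite uv_l wx_l !eqxx /= negbK => /eqP.
Qed.

(** * The Gray code cover for SOS2 *)

Section GraySOS2.
Context (m L : nat) (h : nat -> {ffun 'I_L -> bool}).
Hypotheses (m_gt0 : 0 < m) (L_def : L = up_log 2 (m - 1)).
Hypothesis h_gray : gray_code [seq h i | i <- iota 1 (m - 1)].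
Hypotheses (h_first : h 0 = h 1) (h_last : h m = h (m - 1)).

(** The end conventions repeat the first and last vectors; clipping moves every index into the range
    where the vectors are distinct. *)
Lemma gray_clip i : 1 < m -> i <= m -> h i = h (minn (maxn i 1) (m - 1)).
Proof.
move=> m_gt1 i_le; have [->|i_neq0] := eqVneq i 0.
  by rewrite h_first; congr h; lia.
have [->|i_neqm] := eqVneq i m; first by rewrite h_last; congr h; lia.
by congr h; lia.
Qed.

(** Clipping can only raise the smaller index to 1 or lower the larger one to [m - 1], and the two
    stay distinct. *)
Lemma gray_far i i' r s : r + 2 <= s -> s < m -> i \in [:: r; r.+1] -> i' \in [:: s; s.+1] ->
  h i != h i'.
Proof.
rewrite !inE => rs sm ir is'.
rewrite (gray_clip i) ?(gray_clip i'); try lia.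
apply/eqP=> /(gray_code_inj _ _ _ h_gray); lia.
Qed.

(** The repeated vectors at the two ends differ in no bit, hence a bound instead of an equality. *)
Lemma gray_step_le1 r : r < m -> #|[set l | h r l != h r.+1 l]| <= 1.
Proof.
move=> r_lt.
have same : h r = h r.+1 -> #|[set l | h r l != h r.+1 l]| <= 1.
  move=> ->; rewrite (_ : [set _ | _] = set0) ?cards0 //.
  by apply/setP=> l; rewrite !inE eqxx.
have [r0|r_gt0] := posnP r; first by apply: same; rewrite r0.
have [r_lt'|r_ge] := ltnP r (m - 1); first by rewrite (gray_code_step _ _ _ h_gray) ?r_gt0.
by apply: same; rewrite (_ : r = m - 1) ?h_last -?h_last; [congr h; lia|lia].
Qed.

Lemma mem_gray_set b l (t : 'I_m) :
  (t \in gray_set m 1 h b l) = (h t l == b) && (h t.+1 l == b).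
Proof. by rewrite inE /sos_label cdivnS // divn1 subSS subn0. Qed.

Lemma gray_bit_attained b l : exists2 i, 0 < i <= m - 1 & h i l = b.
Proof.
(* The existence of the bit [l] rules out codes with at most one vector, for which [up_log] is 0. *)
have L_gt0 : 0 < L by apply: leq_ltn_trans (ltn_ord l).
have n_gt1 : 1 < m - 1 by have := up_log_gt0 2 (m - 1); rewrite -L_def L_gt0.
have [/hasP[i]|/hasPn no_b] := boolP (has (fun i => h i l == b) (iota 1 (m - 1))).
  by rewrite mem_iota => i_in /eqP; exists i => //; lia.
(* Flipping bit l then doubles the number of vectors of the code, which already
   exceeds half of 2 ^ L. *)
pose flip (p : 'I_(m - 1) * bool) := [ffun l' => h p.1.+1 l' (+) (p.2 && (l' == l))].
have hl (i : 'I_(m - 1)) : h i.+1 l = ~~ b.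
  have := no_b i.+1; rewrite mem_iota add1n !ltnS leq0n ltn_ord => /(_ isT).
  by case: (h _ l) (b) => [] [].
have flip_inj : injective flip.
  move=> [i c] [i' c'] /ffunP eq_flip.
  have cc' : c = c'.
    have := eq_flip l; rewrite !ffunE /= !hl eqxx !andbT.
    by case: (b) (c) (c') => [] [] [].
  congr pair => //; apply: val_inj; apply: succn_inj.
  apply: (gray_code_inj _ _ _ h_gray); rewrite ?ltn_ord //; apply/ffunP=> l'.
  by have := eq_flip l'; rewrite !ffunE /= cc' => /addIb.
have := leq_card flip flip_inj.
rewrite card_prod card_ffun !card_bool !card_ord.
have := up_log_gtn (p := 2) (n := m - 1) isT n_gt1; rewrite -L_def.
by have := expnS 2 L.-1; rewrite prednK //; lia.
Qed.

(** Membership asks for [b] at two consecutive indices. If an occurrence of [b] had no such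
    neighbour, the steps before and after it would both flip bit [l] alone, and the code would
    repeat a vector. *)
Lemma gray_set_neq0 b l : gray_set m 1 h b l != set0.
Proof.
have [i i_in hi] := gray_bit_attained b l.
suff [t t_lt ht] : exists2 t, t < m & (h t l == b) && (h t.+1 l == b).
  by apply/set0Pn; exists (Ordinal t_lt); rewrite mem_gray_set.
have [hS|hS] := eqVneq (h i.+1 l) b.
  by exists i; [lia|rewrite hi hS eqxx].
have [hP|hP] := eqVneq (h i.-1 l) b.
  by exists i.-1; [lia|rewrite prednK ?hP ?hi ?eqxx //; lia].
(* An isolated b at position i would force h i.-1 = h i.+1. *)
have i_gt1 : 1 < i.
  rewrite ltnNge; apply/negP=> i_le1; move/eqP: hP; apply.
  by rewrite (_ : i = 1) /= ?h_first -?hi; [congr (h _ l); lia|lia].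
have i_lt : i < m - 1.
  rewrite ltnNge; apply/negP=> i_ge; move/eqP: hS; apply.
  by rewrite (_ : i.+1 = m) ?h_last -?hi; [congr (h _ l); lia|lia].
have /card_le1_eqP stepP : #|[set l | h i.-1 l != h i.-1.+1 l]| <= 1.
  by apply: gray_step_le1; lia.
have /card_le1_eqP stepS : #|[set l | h i l != h i.+1 l]| <= 1.
  by apply: gray_step_le1; lia.
rewrite prednK in stepP; last lia.
have : h i.-1 = h i.+1.
  apply/ffunP=> l'; have [->|l'l] := eqVneq l' l.
    by move: hP hS; case: (h i.-1 l) (h i.+1 l) (b) => [] [] [].
  transitivity (h i l').
    apply: contraNeq l'l => neq; apply/eqP; apply: stepP; rewrite inE //.
    by rewrite hi.
  apply: contraNeq l'l => neq; apply/eqP; apply: stepS; rewrite inE //.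
  by rewrite hi eq_sym.
by move/(gray_code_inj _ _ _ h_gray); lia.
Qed.

(** A bit that is 0 at [r], [r.+1] and 1 at [s], [s.+1] shows that these index pairs are disjoint,
    which is an SOS2 conflict. Conversely, disjoint index pairs carry different vectors, so some bit
    separates them. *)
Lemma biclique_cover_gray : biclique_cover (conflict_graph (SOS 2 m)) (gray_family m 1 h).
Proof.
have edge2 (r s : 'I_m) :
    ([set r; s] \in conflict_graph (SOS 2 m)) = (r + 2 <= s) || (s + 2 <= r).
  by rewrite edge_conflict_SOS //; lia.
apply/(biclique_coverP _ _ (card_conflict_edge _)); split; [|split].
- by move=> p /mapP[l _ ->]; rewrite !gray_set_neq0.
- move=> p r s /mapP[l _ ->]; rewrite !mem_gray_set edge2.
  move=> /andP[/eqP r0 /eqP r1] /andP[/eqP s0 /eqP s1].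
  have rs : (r : nat) <> s by move=> eq_rs; rewrite eq_rs s0 in r0.
  have rs1 : (r.+1 : nat) <> s by move=> eq_rs; rewrite eq_rs s0 in r1.
  have sr1 : (s.+1 : nat) <> r by move=> eq_rs; rewrite eq_rs r0 in s1.
  lia.
move=> r s; wlog rs : r s / r + 2 <= s => [IH rs|_].
  move: (rs); rewrite edge2 => /orP[/IH|/IH]; first exact.
  by rewrite setUC => /(_ rs)[p pc prs]; exists p; rewrite // orbC.
have [l] : exists l, [&& h r l == h r.+1 l, h s l == h s.+1 l & h r l != h s l].
  apply: separating_coordinate; try exact: gray_step_le1;
    by apply: (gray_far _ _ r s); rewrite // !inE eqxx ?orbT.
case/and3P=> /eqP rr /eqP ss rs_l.
exists (gray_set m 1 h false l, gray_set m 1 h true l).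
  by apply/mapP; exists l; rewrite ?mem_enum.
rewrite !mem_gray_set -rr -ss.
by move: rs_l; case: (h r l) (h s l) => [] [].
Qed.
End GraySOS2.

(** * From SOS2 on the blocks to the theorem *)

Lemma gray_family_blocks (N k L : nat) (h : nat -> {ffun 'I_L -> bool}) :
  0 < k -> k %| N -> gray_family N k h = block_family N k (gray_family (N %/ k) 1 h).
Proof.
move=> k_gt0 k_dvd_N; rewrite /block_family -map_comp; apply: eq_map => l /=.
have preimE b : gray_set N k h b l = block_preim N k (gray_set (N %/ k) 1 h b l).
  apply/setP=> t; rewrite (mem_block_preim _ _ _ _ _ (Ordinal (block_lt _ _ k_gt0 k_dvd_N t))) //.
  by rewrite mem_gray_set inE /sos_label cdivnS // subSS subn0.
by rewrite !preimE.
Qed.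

Theorem theorem5 (N k : nat) (k_gt0 : 0 < k) (k_le_N : k <= N) (k_dvd_N : k %| N) :
  (forall c : seq ({set 'I_(N %/ k)} * {set 'I_(N %/ k)}),
     biclique_cover (conflict_graph (SOS 2 (N %/ k))) c ->
     (3 * k <= N ->
        biclique_cover (conflict_graph (SOS k N)) (block_family N k c ++ shift_family N k))
     /\ biclique_cover (conflict_graph (SOS k N))
          (nonempty_pairs (block_family N k c ++ shift_family N k)))
  /\
  (forall h : nat -> {ffun 'I_(up_log 2 (cdivn N k - 1)) -> bool},
     gray_code [seq h i | i <- iota 1 (cdivn N k - 1)] ->
     h 0 = h 1 ->
     h (cdivn N k) = h (cdivn N k - 1) ->
     size (gray_family N k h ++ shift_family N k) = up_log 2 (cdivn N k - 1) + 3 * k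
     /\ (3 * k <= N ->
           biclique_cover (conflict_graph (SOS k N)) (gray_family N k h ++ shift_family N k))
     /\ biclique_cover (conflict_graph (SOS k N))
          (nonempty_pairs (gray_family N k h ++ shift_family N k))).
Proof.
split=> [c|h h_gray h_first h_last]; first exact: biclique_cover_block_shift.
split; first by rewrite size_cat; congr (_ + _); rewrite size_map ?size_enum_ord ?size_iota.
(* By divisibility the ceiling is the exact number of blocks. *)
have m_def : cdivn N k = N %/ k.
  by rewrite /cdivn divnDl // (divn_small (m := k.-1)) ?addn0 // prednK.
rewrite gray_family_blocks //; apply: biclique_cover_block_shift => //.
by apply: biclique_cover_gray; rewrite -?m_def // m_def divn_gt0.
Qed.
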